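(* For every integer $r\geq 2$ there exists $n_0$ such that if $G$ is a graph on $n\geq n_0$ vertices with minimum degree $\delta(G)> \left(1-\frac{1}{e\,r!}\right)n$, then $\mathrm{tp}_r(G)\leq r$.
   Context: Graphs are finite and simple; $e$ is the base of the natural logarithm. An $r$-coloring of a graph $G$ is an arbitrary assignment of one of $r$ colors to each edge of $G$. The $r$-color tree-partition number $\mathrm{tp}_r(G)$ is the minimum $s$ such that for every $r$-coloring of the edges of $G$ there exists a collection of monochromatic connected subgraphs $\{H_1,\dots,H_t\}$ of $G$ with $t\leq s$ such that $\{V(H_1),\dots,V(H_t)\}$ is a partition of $V(G)$. (A single vertex counts as a monochromatic connected subgraph.) *)

(* Defs.v *)
From mathcomp Require Import all_boot.

Set Implicit Arguments.
Unset Strict Implicit.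
Unset Printing Implicit Defensive.

(* A finite simple graph; its edges are 2-element sets of vertices. *)
Record sgraph := SGraph {
  vertex :> finType;
  edges : {set {set vertex}};
  edges_card2 : forall f, f \in edges -> #|f| = 2 }.

Definition adj (G : sgraph) : rel G := fun x y => [set x; y] \in edges G.

Definition degree (G : sgraph) (x : G) : nat := #|[set y | adj x y]|.

(* Degrees never exceed #|G|, so this default value does not affect the
   minimum; on the graph without vertices the result is 0. *)
Definition min_degree (G : sgraph) : nat :=
  \big[minn/#|G|]_(x : G) degree x.

Definition edge (G : sgraph) : finType := {f : {set G} | f \in edges G}.

Definition coloring (r : nat) (G : sgraph) : finType := {ffun edge G -> 'I_r}.

(* Pairs (vertex set, edge set) of candidate subgraphs; being a subgraph of G
   is the separate predicate is_subgraph. *)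
Definition subgraph (G : sgraph) : finType :=
  ({set G} * {set {set G}})%type.

Definition subV (G : sgraph) (H : subgraph G) : {set G} := H.1.
Definition subE (G : sgraph) (H : subgraph G) : {set {set G}} := H.2.

Definition is_subgraph (G : sgraph) (H : subgraph G) : bool :=
  (subE H \subset edges G) && [forall f in subE H, f \subset subV H].

Definition is_connected (G : sgraph) (H : subgraph G) : bool :=
  (subV H != set0) &&
  [forall x in subV H, forall y in subV H,
     connect (fun u v => [set u; v] \in subE H) x y].

(* A subgraph without edges is monochromatic, whatever the colors are. *)
Definition monochromatic (r : nat) (G : sgraph) (c : coloring r G)
    (H : subgraph G) : bool :=
  [forall f : edge G, forall g : edge G,
     (val f \in subE H) && (val g \in subE H) ==> (c f == c g)].

(* Injectivity of subV on C says that V(H_1), ..., V(H_t) are disjoint as an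
   indexed family, not only as a set of sets. *)
Definition tree_partition (r : nat) (G : sgraph) (c : coloring r G)
    (C : {set subgraph G}) : bool :=
  [&& [forall H in C, [&& is_subgraph H, is_connected H & monochromatic c H]],
      partition [set subV H | H in C] [set: G]
    & [forall H in C, forall K in C, (subV H == subV K) ==> (H == K)]].

Definition tree_partitionable (r : nat) (G : sgraph) (s : nat) : bool :=
  [forall c : coloring r G,
     exists C : {set subgraph G}, (#|C| <= s) && tree_partition c C].

Lemma tree_partitionable_ex (r : nat) (G : sgraph) :
  exists s, tree_partitionable r G s.
Proof.
exists #|G|; apply/forallP => c; apply/existsP.
pose h (v : G) : subgraph G := ([set v], set0).
exists [set h v | v : G]; apply/andP; split; first exact: leq_imset_card.
apply/and3P; split.
- apply/forall_inP => _ /imsetP[v _ ->]; apply/and3P; split.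
  + by rewrite /is_subgraph sub0set; apply/forall_inP => f; rewrite inE.
  + apply/andP; split; first by apply/set0Pn; exists v; rewrite inE.
    apply/forall_inP => x /set1P ->; apply/forall_inP => y /set1P ->.
    exact: connect0.
  + by apply/forallP => f; apply/forallP => g; rewrite !inE.
- apply/and3P; split.
  + apply/eqP/setP => x; rewrite inE; apply/bigcupP; exists [set x].
      by apply/imsetP; exists (h x) => //; apply: imset_f.
    by rewrite inE.
  + apply/trivIsetP => A B /imsetP[H /imsetP[v _ ->] ->].
    move=> /imsetP[K /imsetP[w _ ->] ->]; rewrite /subV /= => vw.
    by rewrite disjoints1 inE; apply: contraNneq vw => ->.
  + apply/imsetP => -[H /imsetP[v _ ->]] /setP/(_ v).
    by rewrite /subV /= !inE eqxx.
- apply/forall_inP => H /imsetP[v _ ->].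
  apply/forall_inP => K /imsetP[w _ ->].
  by apply/implyP => /eqP/set1_inj ->.
Qed.

Definition tp (r : nat) (G : sgraph) : nat :=
  ex_minn (tree_partitionable_ex r G).

(* Main.v *)
(* Following Haxell and Kohayakawa, stars with a common set Y of leaves are grown
   greedily: for every color i of a set S there is a root x i joined in color i
   to all of Y.  If some vertex v has fewer than t edges to Y in each color of S,
   then most of Y is joined to v by the other colors; the most frequent of these,
   with root v, is added to S and Y shrinks to the neighbors of v in that color.
   When j colors remain, Y loses at most D vertices (non-neighbors of v and edges
   in the colors of S) and is then divided by j, so the process can continue
   with all r colors as long as n > D * (sum of r!/k! over k <= r), and this sum
   is less than e r!.  At the end, when every vertex has t edges to Y in a single
   color of S, a random coloring of Y with t of order sqrt n gives every vertex
   a neighbor in Y of the right color, hence a path of length at most 2 to its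
   root. *)
Require Import Defs.
From mathcomp Require Import all_boot all_order all_algebra.
From mathcomp Require Import reals.
From mathcomp Require Import sequences exp.
From mathcomp Require Import zify.

Set Implicit Arguments.
Unset Strict Implicit.
Unset Printing Implicit Defensive.

Import Order.TTheory GRing.Theory Num.Theory.

(** * The random coloring by counting, and the choice of [t] *)

(** Union bound: a uniformly random [f] avoids the value [a v] on all of [N v] with probability at
    most ((r - 1) / r) ^ t, and these bounds sum to less than 1 over [I]. *)
Lemma exists_hitting_function (I V : finType) (r t : nat)
    (N : I -> {set V}) (a : I -> 'I_r) :
    0 < r -> (forall v, t <= #|N v|) -> #|I| * r.-1 ^ t < r ^ t ->
  exists f : {ffun V -> 'I_r}, forall v, exists2 y, y \in N v & f y = a v.
Proof.
move=> r_gt0 leN ltIr.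
pose avoid v y := if y \in N v then predC1 (a v) else predT.
pose bad v : {set {ffun V -> 'I_r}} := [set f in family (avoid v)].
have bad_le v : #|bad v| * r ^ t <= r.-1 ^ t * r ^ #|V|.
  rewrite cardsE card_family foldrE big_image /=.
  rewrite (bigID (mem (N v))) /=.
  rewrite (eq_bigr (fun=> r.-1)) => [|y yN]; last first.
    by rewrite /avoid yN cardC1 card_ord.
  rewrite [X in _ * X * _](eq_bigr (fun=> r)) => [|y yN]; last first.
    by rewrite /avoid (negPf yN) card_ord.
  rewrite !prod_nat_const -(cardC (mem (N v))).
  have -> : #|[pred y | y \notin N v]| = #|[predC N v]| by apply: eq_card.
  rewrite -(subnKC (leN v)) !expnD -!mulnA leq_mul2l; apply/orP; right.
  rewrite [r ^ _ * r ^ t]mulnC !mulnA leq_mul2r; apply/orP; right.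
  rewrite mulnC leq_mul2l; apply/orP; right.
  by case: (#|N v| - t) => // u; rewrite leq_exp2r ?leq_pred.
have [f fbad] : exists f, f \notin \bigcup_v bad v.
  apply/existsP; rewrite -negb_forall; apply/negP => /forallP all_bad.
  have : #|\bigcup_v bad v| * r ^ t < r ^ #|V| * r ^ t.
    apply: (@leq_ltn_trans (\sum_v #|bad v| * r ^ t)).
      rewrite -big_distrl leq_mul2r /=; apply/orP; right.
      elim/big_ind2: _ => [|A m B n Am Bn|//]; first by rewrite cards0.
      by rewrite (leq_trans (leq_card_setU _ _)) // leq_add.
    apply: (@leq_ltn_trans (\sum_(v : I) r.-1 ^ t * r ^ #|V|)).
      exact: leq_sum.
    by rewrite sum_nat_const mulnA [r ^ _ * _]mulnC ltn_mul2r ltIr andbT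
       expn_gt0 r_gt0.
  rewrite (_ : #|_| = r ^ #|V|) ?ltnn // -[r in RHS]card_ord -card_ffun.
  by apply: eq_card => f; rewrite all_bad.
exists f => v; suff /exists_inP[y yN /eqP] : [exists y in N v, f y == a v].
  by exists y.
apply: contraNT fbad.
rewrite negb_exists => /forallP hf; apply/bigcupP; exists v => //.
rewrite inE; apply/familyP => y; rewrite /avoid; case: ifP => // yN.
by have := hf y; rewrite yN.
Qed.

(** Bernoulli's inequality (1 + 1/q) ^ q >= 2 with denominators cleared. *)
Lemma double_expn_self_le (q : nat) : 0 < q -> 2 * q ^ q <= q.+1 ^ q.
Proof.
move=> q_gt0.
have bernoulli m : q ^ m * (q + m) <= q * q.+1 ^ m.
  elim: m => [|m IHm]; first by rewrite !expn0 addn0 mul1n muln1.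
  apply: (@leq_trans (q.+1 * (q ^ m * (q + m)))); last first.
    by rewrite expnS [leqRHS]mulnCA leq_mul2l IHm orbT.
  rewrite expnS [q * q ^ m]mulnC -mulnA [leqRHS]mulnCA leq_mul2l.
  by apply/orP; right; nia.
rewrite -(leq_pmul2l q_gt0); apply: leq_trans (bernoulli q).
by rewrite addnn -mul2n mulnCA [q ^ q * _]mulnC -mulnA.
Qed.

(** For [q + 1] colors and [t = 2 * q * s] this is the hypothesis of the union bound: (1 + 1/q) ^ t
    >= 2 ^ (2 * s) >= (s + 1) ^ 2 > n. *)
Lemma small_mul_expn_lt (q s n : nat) :
  0 < q -> n < s.+1 ^ 2 -> n * q ^ (q * s.*2) < q.+1 ^ (q * s.*2).
Proof.
move=> q_gt0 lt_n.
have lt_n2 : n < 2 ^ s.*2.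
  by rewrite (leq_trans lt_n) // -muln2 expnM leq_exp2r // ltn_expl.
apply: (@leq_trans ((2 * q ^ q) ^ s.*2)).
  by rewrite expnMn -expnM ltn_mul2r lt_n2 expn_gt0 q_gt0.
by rewrite expnM; case: (s.*2) => // k; rewrite leq_exp2r ?double_expn_self_le.
Qed.

Lemma exists_floor_sqrt (n : nat) : exists s, s ^ 2 <= n < s.+1 ^ 2.
Proof.
have ex : exists s, s ^ 2 <= n by exists 0.
have bound s : s ^ 2 <= n -> s <= n by nia.
case: (ex_maxnP ex bound) => s le_s max_s; exists s; rewrite le_s ltnNge.
by apply/negP => /max_s; rewrite ltnn.
Qed.

(** * The size recursion and its comparison with e r! *)

(* The size that Y must exceed while j colors have no root yet, when a vertex
   without many edges to Y in the colors used so far loses at most D of Y. *)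
Fixpoint room (D j : nat) : nat :=
  D + if j is j'.+1 then j * room D j' else 0.

Lemma roomE D j : room D j = D + j * room D j.-1.
Proof. by case: j. Qed.

Lemma room_mul D j : room D j = D * room 1 j.
Proof.
elim: j => [|j IHj]; first by rewrite /= addn0 muln1.
by rewrite /= -/(room _ j) -/(room 1 j) IHj mulnDr muln1 mulnCA.
Qed.

Local Open Scope ring_scope.

(* room 1 j is the sum of j!/k! over k <= j. *)
Lemma room1_series (R : realType) (j : nat) :
  (room 1 j)%:R = j`!%:R * series (exp_coeff (1 : R)) j.+1.
Proof.
elim: j => [|j IHj].
  by rewrite /= seriesEnat /= big_nat1 /exp_coeff /= expr0 fact0 divr1 mulr1.
rewrite /= -/(room 1 j) natrD natrM IHj !seriesEnat /= [in RHS]big_nat_recr //=.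
rewrite mulrDr addrC factS natrM mulrA; congr (_ + _).
by rewrite /exp_coeff /= expr1n mul1r factS natrM divff //
  -natrM -factS pnatr_eq0 -lt0n fact_gt0.
Qed.

Lemma room1_lt (R : realType) (j : nat) :
  (room 1 j)%:R < expR 1 * j`!%:R :> R.
Proof.
rewrite room1_series mulrC ltr_pM2r ?ltr0n ?fact_gt0 //.
have coeff_gt0 k : 0 < exp_coeff (1 : R) k.
  by rewrite /exp_coeff /= expr1n mul1r invr_gt0 ltr0n fact_gt0.
(* Monotone convergence alone gives only a weak inequality; one further positive term makes it
   strict. *)
apply: (@lt_le_trans _ _ (series (exp_coeff (1 : R)) j.+2)).
  by rewrite !seriesEnat /= [ltRHS]big_nat_recr //= ltrDl coeff_gt0.
apply: (nondecreasing_cvgn_le _ (is_cvg_series_exp_coeff 1)).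
apply/nondecreasing_seqP => k.
by rewrite !seriesEnat /= [leRHS]big_nat_recr //= lerDl ltW.
Qed.

Local Close Scope ring_scope.

(** * Color classes of a vertex map, and the growth of stars *)

Definition cadj (r : nat) (G : sgraph) (c : coloring r G) (i : 'I_r) : rel G :=
  fun x y => [exists f : edge G, (val f == [set x; y]) && (c f == i)].

Section Coloring.

Variables (r : nat) (G : sgraph) (c : coloring r G).

Lemma adj_irr (x : G) : adj x x = false.
Proof. by apply/negP => /edges_card2; rewrite setUid cards1. Qed.

Lemma cadj_sym i : symmetric (cadj c i).
Proof. by move=> x y; rewrite /cadj setUC. Qed.

Lemma cadjP i x y :
  reflect (exists2 f : edge G, val f = [set x; y] & c f = i) (cadj c i x y).
Proof.
apply: (iffP existsP) => [[f /andP[/eqP fxy /eqP cf]]|[f fxy cf]].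
  by exists f.
by exists f; rewrite fxy cf !eqxx.
Qed.

Lemma cadj_adj i x y : cadj c i x y -> adj x y.
Proof. by move=> /cadjP[f fxy _]; rewrite /adj -fxy; apply: (valP f). Qed.

Lemma adjE x y : adj x y = [exists i, cadj c i x y].
Proof.
apply/idP/existsP => [xy|[i /cadj_adj//]].
by exists (c (Sub [set x; y] xy)); apply/cadjP; exists (Sub [set x; y] xy).
Qed.

(** Keeping only edges of color [i] inside the class makes it a monochromatic subgraph for every
    [g], so that only connectedness depends on the choice of [g]. *)
Definition color_class (g : G -> 'I_r) (i : 'I_r) : subgraph G :=
  ([set v | g v == i],
   [set f in edges G | [exists x, exists y,
      [&& f == [set x; y], cadj c i x y, g x == i & g y == i]]]).

Lemma color_class_edge g i x y :
  cadj c i x y -> g x = i -> g y = i -> [set x; y] \in subE (color_class g i).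
Proof.
move=> xy gx gy; rewrite inE (cadj_adj xy : _ \in edges G).
by apply/existsP; exists x; apply/existsP; exists y; rewrite xy gx gy !eqxx.
Qed.

Lemma color_class_subgraph g i : is_subgraph (color_class g i).
Proof.
apply/andP; split; first by apply/subsetP => f; rewrite inE => /andP[].
apply/forall_inP => f; rewrite inE => /andP[_ /existsP[x /existsP[y]]].
case/and4P => /eqP -> _ gx gy.
by apply/subsetP => z; rewrite !inE => /orP[]/eqP->.
Qed.

Lemma color_class_monochromatic g i : monochromatic c (color_class g i).
Proof.
suff mono (f : edge G) : val f \in subE (color_class g i) -> c f = i.
  by do 2!apply/forallP => ?; apply/implyP => /andP[/mono -> /mono ->].
rewrite inE => /andP[_ /existsP[x /existsP[y]]].
case/and4P => /eqP fxy /cadjP[f' f'xy <-] _ _.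
by congr (c _); apply: val_inj; rewrite f'xy.
Qed.

Lemma color_class_connected g i (x : G) :
  g x = i ->
  (forall v, g v = i ->
     connect (fun u w => [set u; w] \in subE (color_class g i)) v x) ->
  is_connected (color_class g i).
Proof.
move=> gx conn; apply/andP; split.
  by apply/set0Pn; exists x; rewrite inE gx.
apply/forall_inP => u; rewrite inE => /eqP gu.
apply/forall_inP => w; rewrite inE => /eqP gw.
apply: connect_trans (conn u gu) _.
rewrite sym_connect_sym; first exact: conn.
by move=> ? ?; rewrite setUC.
Qed.

(* The trees are the color classes of a map from vertices to colors: the roots
   keep their own color, the leaves in Y are coloured by a function hitting
   all the neighborhoods N v, and any other vertex follows a. *)
Lemma tree_partition_of_stars (S : {set 'I_r}) (t : nat) (x : 'I_r -> G)
    (Y : {set G}) :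
  0 < r -> #|G| * r.-1 ^ t < r ^ t -> {in S &, injective x} ->
  (forall i y, i \in S -> y \in Y -> cadj c i (x i) y) ->
  (forall v, exists2 i, i \in S & t <= #|[set y in Y | cadj c i v y]|) ->
  exists C : {set subgraph G}, (#|C| <= r) && tree_partition c C.
Proof.
move=> r_gt0 ltGr x_inj xY good.
have /fin_all_exists2[a aS leN] := good.
have [f fN] := exists_hitting_function a r_gt0 leN ltGr.
have xNY i : i \in S -> x i \notin Y.
  by move=> iS; apply/negP => /(xY _ _ iS)/cadj_adj; rewrite adj_irr.
(* [f] may take colors outside [S], which have no root; such vertices of [Y] follow [a]. *)
pose g v := if [pick i in S | x i == v] is Some i then i
  else if (v \in Y) && (f v \in S) then f v else a v.
have gx i : i \in S -> g (x i) = i.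
  move=> iS; rewrite /g; case: pickP => [j /andP[jS /eqP /x_inj->//]|].
  by move=> /(_ i); rewrite iS eqxx.
have gY y : y \in Y -> f y \in S -> g y = f y.
  move=> yY fyS; rewrite /g; case: pickP => [i /andP[iS /eqP xy]|_].
    by have := xNY i iS; rewrite xy yY.
  by rewrite yY fyS.
have gS v : g v \in S.
  rewrite /g; case: pickP => [i /andP[]//|_].
  by case: ifP => [/andP[]|].
pose H := color_class g.
have subVH i v : (v \in subV (H i)) = (g v == i) by rewrite inE.
exists [set H i | i in S]; apply/andP; split.
  by rewrite (leq_trans (leq_imset_card _ _)) // -[leqRHS]card_ord max_card.
have H_inj : {in S, forall i K, K \in [set H i | i in S] ->
    x i \in subV K -> K = H i}.
  by move=> i iS _ /imsetP[j jS ->]; rewrite subVH gx // => /eqP->.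
apply/and3P; split.
- apply/forall_inP => _ /imsetP[i iS ->].
  rewrite color_class_subgraph color_class_monochromatic andbT /=.
  apply: (color_class_connected (gx i iS)) => v gv.
  rewrite sym_connect_sym; last by move=> ? ?; rewrite setUC.
  have edgex y : y \in Y -> g y = i ->
      connect (fun u w => [set u; w] \in subE (H i)) (x i) y.
    by move=> yY gy; apply/connect1/color_class_edge; rewrite ?gx // xY.
  move: (gv); rewrite /g; case: pickP => [j /andP[jS /eqP <-] ->//|_].
  case: ifP => [/andP[vY _] _|_ av]; first exact: edgex.
  (* Here [v] follows [a]: a neighbor [y] in [Y] with [f y = i] links [v] to the root [x i]. *)
  have [y] := fN v; rewrite av inE => /andP[yY vy] fy.
  have gy : g y = i by rewrite gY // fy.
  apply: connect_trans (edgex y yY gy) _.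
  by apply/connect1/color_class_edge; rewrite // cadj_sym.
- apply/and3P; split.
  + apply/eqP/setP => v; rewrite inE; apply/bigcupP.
    exists (subV (H (g v))); first by do 2!apply: imset_f.
    by rewrite subVH.
  + apply/trivIsetP => A B /imsetP[_ /imsetP[i _ ->] ->].
    move=> /imsetP[_ /imsetP[j _ ->] ->] neqij.
    apply/pred0P => v /=; rewrite !subVH; apply/negP => /andP[/eqP gv].
    by rewrite gv => /eqP ij; rewrite ij eqxx in neqij.
  + apply/imsetP => -[_ /imsetP[i iS ->]] /setP/(_ (x i)).
    by rewrite subVH gx // eqxx inE.
- apply/forall_inP => _ /imsetP[i iS ->]; apply/forall_inP => K KC.
  apply/implyP => /eqP eqV; rewrite (H_inj i iS K) // -eqV subVH gx //.
Qed.

Lemma exists_stars (D t : nat) :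
  0 < r -> (forall v : G, #|[set y | ~~ adj v y]| <= D) ->
  forall (j : nat) (S : {set 'I_r}) (x : 'I_r -> G) (Y : {set G}),
  #|~: S| = j -> room (D + r * t) j < #|Y| -> {in S &, injective x} ->
  (forall i y, i \in S -> y \in Y -> cadj c i (x i) y) ->
  exists (S' : {set 'I_r}) (x' : 'I_r -> G) (Y' : {set G}),
  [/\ {in S' &, injective x'},
      forall i y, i \in S' -> y \in Y' -> cadj c i (x' i) y
    & forall v, exists2 i, i \in S' & t <= #|[set y in Y' | cadj c i v y]|].
Proof.
move=> r_gt0 nonadj_le j; elim/ltn_ind: j => j IHj S x Y cardS ltY x_inj xY.
pose Ni v i := [set y in Y | cadj c i v y].
have [/forallP good|] := boolP [forall v, exists i in S, t <= #|Ni v i|].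
  by exists S, x, Y; split=> // v; have /exists_inP[i] := good v; exists i.
rewrite negb_forall => /existsP[v]; rewrite negb_exists_in => /forall_inP bad.
have {}bad i : i \in S -> #|Ni v i| < t by move=> /bad; rewrite -ltnNge.
have coverY : #|Y| <= D + \sum_i #|Ni v i|.
  apply: (@leq_trans #|[set y | ~~ adj v y] :|: \bigcup_i Ni v i|).
    apply/subset_leq_card/subsetP => y yY; rewrite !inE adjE.
    case: existsP => //= -[i vy]; apply/bigcupP; exists i => //.
    by rewrite inE yY.
  rewrite (leq_trans (leq_card_setU _ _)) // leq_add //.
  elim/big_ind2: _ => [|A m B n Am Bn|//]; first by rewrite cards0.
  by rewrite (leq_trans (leq_card_setU _ _)) // leq_add.
have sumS : \sum_(i in S) #|Ni v i| <= r * t.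
  apply: (@leq_trans (\sum_(i in S) t)).
    by apply: leq_sum => i /bad/ltnW.
  rewrite sum_nat_const leq_mul2r; apply/orP; right.
  by rewrite -[leqRHS]card_ord max_card.
(* Pigeonhole over the [j] colors outside [S]. For [j = 0] the same count contradicts the size of
   [Y], so the process stops at the latest when all colors have roots. *)
have /existsP[i /andP[iS lti]] :
    [exists i, (i \notin S) && (room (D + r * t) j.-1 < #|Ni v i|)].
  apply: contraLR ltY; rewrite negb_exists => /forallP small.
  rewrite -leqNgt roomE (leq_trans coverY) // (bigID (mem S)) /= addnA.
  apply: leq_add; first by rewrite leq_add2l.
  apply: (@leq_trans (\sum_(i in ~: S) room (D + r * t) j.-1)).
    rewrite big_mkcond [leqRHS]big_mkcond; apply: leq_sum => i _.
    by have := small i; rewrite inE; case: (i \in S) => //=; rewrite -leqNgt.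
  by rewrite sum_nat_const cardS.
have cardS' : #|~: (i |: S)| = j.-1.
  rewrite -cardS setCU setIC -setDE.
  by rewrite [in RHS](cardsD1 i) inE iS.
have j_gt0 : 0 < j by rewrite -cardS; apply/card_gt0P; exists i; rewrite inE.
(* An old root sees all of [Y] in its color, and [Y] has at least [t] vertices, whereas [v] sees
   fewer than [t]. *)
have neq_x k : k \in S -> x k != v.
  move=> kS; apply/eqP => xk; have := bad k kS; rewrite ltnNge => /negP; apply.
  apply: (@leq_trans #|Y|).
    apply: leq_trans (ltnW ltY); rewrite roomE -addnA addnCA.
    by apply: leq_trans (leq_addr _ _); rewrite leq_pmull.
  apply/subset_leq_card/subsetP => y yY.
  by rewrite inE yY -xk xY.
pose x' k := if k == i then v else x k.
apply: (IHj j.-1 _ (i |: S) x' (Ni v i)) => //.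
- by rewrite prednK.
- move=> k l; rewrite !inE /x'.
  case: (eqVneq k i) => [->|_]; case: (eqVneq l i) => [->|_] //= kS lS.
  + by move=> vx; have := neq_x l lS; rewrite vx eqxx.
  + by move=> vx; have := neq_x k kS; rewrite vx eqxx.
  + exact: x_inj.
- move=> k y; rewrite !inE /x'; case: eqVneq => [->|_] /= kS /andP[yY vy] //.
  exact: xY.
Qed.

End Coloring.

(** * From minimum degree to the asymptotic statement *)

Lemma min_degree_le (G : sgraph) (x : G) : min_degree G <= degree x.
Proof.
rewrite /min_degree; have := mem_index_enum x.
elim: (index_enum _) => // y s IHs; rewrite inE big_cons geq_min.
by case: eqVneq => [->|_ /IHs ->]; rewrite ?leqnn ?orbT.
Qed.

Lemma min_degree_le_card (G : sgraph) : min_degree G <= #|G|.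
Proof.
rewrite /min_degree; elim/big_rec: _ => // x m _ lem.
by rewrite geq_min lem orbT.
Qed.

Lemma tp_le_of_min_degree (r t : nat) (G : sgraph) :
  0 < r -> #|G| * r.-1 ^ t < r ^ t ->
  room (#|G| - min_degree G + r * t) r < #|G| -> tp r G <= r.
Proof.
move=> r_gt0 ltGr ltG.
have nonadj_le (v : G) : #|[set y | ~~ adj v y]| <= #|G| - min_degree G.
  have -> : [set y | ~~ adj v y] = ~: [set y | adj v y].
    by apply/setP => y; rewrite !inE.
  by rewrite cardsCs setCK leq_sub2l ?min_degree_le.
rewrite /tp; case: ex_minnP => m _; apply.
apply/forallP => c; apply/existsP.
have /card_gt0P[v0 _] : 0 < #|G| by apply: leq_ltn_trans ltG.
have [||i j|i y|S [x [Y [x_inj xY good]]]] := exists_stars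
  (c := c) (t := t) r_gt0 nonadj_le (j := r) (S := set0)
  (x := fun=> v0) (Y := [set: G]).
- by rewrite setC0 cardsT card_ord.
- by rewrite cardsT.
- by rewrite inE.
- by rewrite inE.
exact: tree_partition_of_stars r_gt0 ltGr x_inj xY good.
Qed.

Local Open Scope ring_scope.

Theorem corollary1p4 (R : realType) (r : nat) (hr : (2 <= r)%N) :
  exists n0 : nat, forall (n : nat) (G : sgraph),
    (n0 <= n)%N -> #|G| = n ->
    (min_degree G)%:R > (1 - 1 / (expR 1 * r`!%:R)) * n%:R :> R ->
    (tp r G <= r)%N.
Proof.
set P : R := expR 1 * r`!%:R; set B := room 1 r.
have P_gt0 : 0 < P by rewrite mulr_gt0 ?expR_gt0 // ltr0n fact_gt0.
have B_gt0 : 0 < B%:R :> R by rewrite ltr0n /B; case: (r).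
(* The non-neighbors use less than [B / P * n] of the available [n]; the remaining [gap * n] must
   absorb [B * r * t], of order sqrt n. *)
pose gap : R := 1 - B%:R / P.
have gap_gt0 : 0 < gap by rewrite subr_gt0 ltr_pdivrMr // mul1r room1_lt.
(* With [t = 2 * (r - 1) * s], the bound [K <= s] yields [B * r * t <= gap * s ^ 2], and
   [n >= K ^ 2] forces [K <= s]. *)
pose K := Num.bound ((r * (r.-1 * 2) * B)%:R / gap).
have ltK : (r * (r.-1 * 2) * B)%:R / gap < K%:R.
  by apply: archi_boundP; rewrite divr_ge0 ?ler0n ?ltW.
exists (K ^ 2)%N => n G leKn cardG ltdeg.
have [s /andP[le_sn lt_ns]] := exists_floor_sqrt n.
have leKs : (K <= s)%N.
  by rewrite -ltnS -(@ltn_exp2r _ _ 2) // (leq_ltn_trans leKn).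
apply: (@tp_le_of_min_degree _ (r.-1 * s.*2)); rewrite ?cardG; first by lia.
  by have := @small_mul_expn_lt r.-1 s n; rewrite prednK; [apply; lia | lia].
rewrite room_mul -/B -(ltr_nat R) natrM natrD natrB; last first.
  by rewrite -cardG min_degree_le_card.
have slack : (r * (r.-1 * s.*2))%:R * B%:R <= gap * n%:R :> R.
  rewrite (_ : _ * _ = (r * (r.-1 * 2) * B)%:R * s%:R); last first.
    by rewrite -!natrM; congr _%:R; lia.
  apply: (@le_trans _ _ (gap * (s ^ 2)%:R)).
    rewrite -mulnn [(s * s)%:R]natrM mulrA ler_wpM2r ?ler0n //
      mulrC -ler_pdivrMr //.
    by rewrite (le_trans (ltW ltK)) // ler_nat.
  by rewrite ler_wpM2l ?ler_nat // ltW.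
have missing : (n%:R - (min_degree G)%:R) * B%:R < B%:R / P * n%:R :> R.
  rewrite mulrC -mulrA ltr_pM2l //.
  by move: ltdeg; rewrite mulrBl !mul1r !ltrBlDr addrC.
rewrite mulrDl; apply: lt_le_trans (ltr_leD missing slack) _.
by rewrite -mulrDl addrC subrK mul1r.
Qed.
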